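(* For all $\Phi\cup\{\varphi\}\subseteq Fm(C)$ and $m\in\{3,4,5\}$: if $\Phi\vdash_m\varphi$, then $\Phi\Vdash_m\varphi$.
   Context: Language: $Fm(C)$ is the set of formulas built from propositional variables $V=\{x_0,x_1,\dots\}$, a set $C$ of propositional constants containing $\top,\bot$, connectives $\neg,\rightarrow,\vee,\wedge$, the identity connective $\equiv$, the necessity operator $\square$ and the universal propositional quantifier $\forall$ ($\forall x\varphi$ is a formula only if $x$ occurs free in $\varphi$). $\varphi[x:=\psi]$ is capture-avoiding substitution (bound variables renamed as needed); $\varphi=_\alpha\psi$ means $\varphi,\psi$ differ only in bound variables. The system $S3^\forall_\equiv$ has as axioms all formulas of the forms: (i) substitution-instances of propositional tautologies; (ii) $\square\varphi\rightarrow\varphi$; (iii) $\square(\varphi\rightarrow\psi)\rightarrow(\square\varphi\rightarrow\square\psi)$; (iv) $\square(\varphi\rightarrow\psi)\rightarrow\square(\square\varphi\rightarrow\square\psi)$; (v) $\varphi\equiv\psi$ whenever $\varphi=_\alpha\psi$; (vi) $(\varphi\equiv\psi)\rightarrow(\varphi\rightarrow\psi)$; (vii) $(\psi\equiv\psi')\rightarrow(\varphi[x:=\psi]\equiv\varphi[x:=\psi'])$ for $x$ free in $\varphi$; (viii) $\forall x(\varphi\equiv\psi)\rightarrow(\forall x\varphi\equiv\forall x\psi)$; (ix) $\forall x\varphi\rightarrow\varphi[x:=\psi]$; (x) $\forall x(\varphi\rightarrow\psi)\rightarrow(\forall x\varphi\rightarrow\forall x\psi)$; (xi) $\forall x(\varphi\rightarrow\psi)\rightarrow(\varphi\rightarrow\forall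 x\psi)$ if $x$ not free in $\varphi$; (xii) $\square\forall x\varphi\rightarrow\forall x\square\varphi$; (xiii) $\forall x\square\varphi\rightarrow\square\forall x\varphi$; the axiom set is closed under: if $\varphi$ is an axiom and $x$ is free in $\varphi$, then $\forall x\varphi$ is an axiom. Rules: Modus Ponens and Axiom Necessitation (from an axiom $\varphi$ infer $\square\varphi$). $S4^\forall_\equiv$ adds $\square\varphi\rightarrow\square\square\varphi$; $S5^\forall_\equiv$ further adds $\neg\square\varphi\rightarrow\square\neg\square\varphi$. $\Phi\vdash_m\varphi$ means $\varphi$ is derivable from $\Phi$ in $Sm^\forall_\equiv$. Semantics: a Boolean prealgebra is $(M,f_\bot,f_\top,f_\neg,f_\vee,f_\wedge,f_\rightarrow,\le)$ with $\le$ a preorder such that $a\approx b:\Leftrightarrow(a\le b$ and $b\le a)$ is a congruence and the quotient is a Boolean algebra with order induced by $\le$ and induced operations as bottom, top, complement, join, meet, implication. A propositional domain is $\mathcal{M}=(M,\mathit{TRUE},\mathit{NEC},f_\bot,f_\top,f_\square,f_\neg,f_\vee,f_\wedge,f_\rightarrow,f_\equiv,f_\forall,\varGamma)$ with $\mathit{NEC},\mathit{TRUE}\subseteq M$, operations of the obvious arities, $f_\forall\colon M^M\to M$, $\varGamma\colon C\to M$ with $\varGamma(\bot)=f_\bot,\varGamma(\top)=f_\top$. An assignment $\gamma\colon V\to M$ extends to $Fm(C)$ by $\gamma(c)=\varGamma(c)$, $\gamma(\square\varphi)=f_\square(\gamma(\varphi))$, $\gamma(\neg\varphi)=f_\neg(\gamma(\varphi))$,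 $\gamma(\varphi@\psi)=f_@(\gamma(\varphi),\gamma(\psi))$, $\gamma(\forall x\varphi)=f_\forall(m\mapsto\gamma_x^m(\varphi))$ ($\gamma_x^m$ is $\gamma$ modified to send $x$ to $m$). $t\colon M\to M$ is $(\varphi,x,\gamma)$-definable if $t(m)=\gamma_x^m(\varphi)$ for all $m$; definable if so for some $\varphi$, $x$ free in $\varphi$, $\gamma$. Put $a\le_\mathcal{M}b:\Leftrightarrow f_\rightarrow(a,b)\in\mathit{NEC}$ and $a\approx_\mathcal{M}b$ iff both directions. $\mathcal{M}$ is an $S3^\forall_\equiv$-model if: (1) if $\mathit{NEC}\neq\varnothing$, $\le_\mathcal{M}$ is a preorder and $(M,f_\bot,f_\top,f_\neg,f_\vee,f_\wedge,f_\rightarrow,\le_\mathcal{M})$ is a Boolean prealgebra; (2) $f_\bot\notin\mathit{TRUE}$, $f_\top\in\mathit{TRUE}$, $f_\rightarrow,f_\neg,f_\wedge,f_\vee$ behave classically w.r.t. $\mathit{TRUE}$, $f_\square(a)\in\mathit{TRUE}\Leftrightarrow a\in\mathit{NEC}$, $f_\equiv(a,b)\in\mathit{TRUE}\Leftrightarrow a=b$, and $f_\forall(t)\in\mathit{TRUE}$ whenever $t$ is definable with image in $\mathit{TRUE}$; (3) if $\mathit{NEC}\neq\varnothing$: $\mathit{NEC}\subseteq\mathit{TRUE}$, $\mathit{NEC}$ is upward closed under $\le_\mathcal{M}$ and closed under $f_\wedge$; (4) if $\mathit{NEC}\neq\varnothing$: $f_\top\le_\mathcal{M}f_\equiv(a,a)$;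 $f_\equiv(a,b)\le_\mathcal{M}f_\rightarrow(a,b)$; $f_\equiv(a,b)\le_\mathcal{M}f_\equiv(t(a),t(b))$ for definable $t$; $f_\square(a)\le_\mathcal{M}a$; $f_\square(f_\rightarrow(a,b))\le_\mathcal{M}f_\rightarrow(f_\square(a),f_\square(b))$; $f_\square(f_\rightarrow(a,b))\le_\mathcal{M}f_\square(f_\rightarrow(f_\square(a),f_\square(b)))$; $f_\forall(t)\le_\mathcal{M}f_\equiv(f_\forall(t_1),f_\forall(t_2))$ and $f_\forall(t)\le_\mathcal{M}f_\rightarrow(f_\forall(t_1),f_\forall(t_2))$ whenever $t_1,t_2$ are $(\varphi,x,\gamma)$-, $(\psi,x,\gamma)$-definable and $t(a)=f_\equiv(t_1(a),t_2(a))$, resp. $t(a)=f_\rightarrow(t_1(a),t_2(a))$; $f_\forall(t)\le_\mathcal{M}t(a)$ for definable $t$; $f_\forall(t)\le_\mathcal{M}f_\rightarrow(b,f_\forall(t'))$ whenever $t'$ is $(\psi,x,\gamma)$-definable, $b$ is the denotation of a sentence and $t(a)=f_\rightarrow(b,t'(a))$; $f_\square(f_\forall(t))\approx_\mathcal{M}f_\forall(a\mapsto f_\square(t(a)))$ for definable $t$; $f_\forall(t)\in\mathit{NEC}$ whenever $t$ is definable with image in $\mathit{NEC}$. The model is normal if $\mathit{NEC}\neq\varnothing$. A normal $S3^\forall_\equiv$-model is an $S4^\forall_\equiv$-model if $f_\square(a)\le_\mathcal{M}f_\square(f_\square(a))$ for all $a$, and an $S4^\forall_\equiv$-model is an $S5^\forall_\equiv$-model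 if $f_\neg(f_\square(a))\le_\mathcal{M}f_\square(f_\neg(f_\square(a)))$ for all $a$. $(\mathcal{M},\gamma)\vDash\varphi:\Leftrightarrow\gamma(\varphi)\in\mathit{TRUE}$. $\Phi\Vdash_m\varphi$ iff for every normal $Sm^\forall_\equiv$-model $\mathcal{M}$ and assignment $\gamma$, $(\mathcal{M},\gamma)\vDash\Phi$ implies $(\mathcal{M},\gamma)\vDash\varphi$.
   Formalization: In the model condition f_∀(t) ≤ f_→(b, f_∀(t')), ''denotation of a sentence'' is read as denotation of any formula under any assignment (so any b); with closed sentences only, the necessitation of axiom (xi) fails in an 8-element S5-model, so the claim would be false. *)

(* Defs.v *)
From HB Require Import structures.
From mathcomp Require Import all_boot all_order.

Set Implicit Arguments.
Unset Strict Implicit.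
Unset Printing Implicit Defensive.

Record constants := Constants {
  const_sort :> Type;
  cbot : const_sort;
  ctop : const_sort;
  _ : cbot <> ctop }.

(* The variable x_n is represented by n.  [expr] also contains the expressions
   [All x phi] with x not free in phi; the formulas are the expressions that
   satisfy [Fm] below. *)
Inductive expr (C : constants) : Type :=
| Var of nat
| Const of C
| Neg of expr C
| Imp of expr C & expr C
| Or of expr C & expr C
| And of expr C & expr C
| Id of expr C & expr C
| Box of expr C
| All of nat & expr C.

Arguments Var {C} _.
Arguments Const {C} _.

Definition Bot {C : constants} : expr C := Const (cbot C).
Definition Top {C : constants} : expr C := Const (ctop C).

Section Syntax.
Variable C : constants.
Implicit Types (phi psi : expr C) (x y : nat).

Fixpoint fv phi : seq nat :=
  match phi with
  | Var x => [:: x]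
  | Const _ => [::]
  | Neg p | Box p => fv p
  | Imp p q | Or p q | And p q | Id p q => fv p ++ fv q
  | All x p => [seq y <- fv p | y != x]
  end.

Fixpoint Fm phi : bool :=
  match phi with
  | Var _ | Const _ => true
  | Neg p | Box p => Fm p
  | Imp p q | Or p q | And p q | Id p q => Fm p && Fm q
  | All x p => (x \in fv p) && Fm p
  end.

Definition update (T : Type) (f : nat -> T) (x : nat) (a : T) : nat -> T :=
  fun y => if y == x then a else f y.

(* [binder s x phi] is the bound variable of the result of applying the
   simultaneous substitution s to [All x phi]: it is x itself unless x would
   capture a free variable of some s y, y free in [All x phi], and otherwise a
   variable larger than all of those. *)
Definition binder (s : nat -> expr C) x phi : nat :=
  let l := flatten [seq fv (s y) | y <- fv (All x phi)] in
  if x \in l then (foldr maxn 0 l).+1 else x.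

Fixpoint ssubst (s : nat -> expr C) phi : expr C :=
  match phi with
  | Var x => s x
  | Const c => Const c
  | Neg p => Neg (ssubst s p)
  | Imp p q => Imp (ssubst s p) (ssubst s q)
  | Or p q => Or (ssubst s p) (ssubst s q)
  | And p q => And (ssubst s p) (ssubst s q)
  | Id p q => Id (ssubst s p) (ssubst s q)
  | Box p => Box (ssubst s p)
  | All x p => let z := binder s x p in All z (ssubst (update s x (Var z)) p)
  end.

Definition subst phi x psi : expr C := ssubst (update Var x psi) phi.

Inductive alpha : expr C -> expr C -> Prop :=
| alpha_rename x y p : y \notin fv p -> alpha (All x p) (All y (subst p x (Var y)))
| alpha_refl p : alpha p p
| alpha_sym p q : alpha p q -> alpha q p
| alpha_trans p q r : alpha p q -> alpha q r -> alpha p r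
| alpha_Neg p p' : alpha p p' -> alpha (Neg p) (Neg p')
| alpha_Imp p p' q q' : alpha p p' -> alpha q q' -> alpha (Imp p q) (Imp p' q')
| alpha_Or p p' q q' : alpha p p' -> alpha q q' -> alpha (Or p q) (Or p' q')
| alpha_And p p' q q' : alpha p p' -> alpha q q' -> alpha (And p q) (And p' q')
| alpha_Id p p' q q' : alpha p p' -> alpha q q' -> alpha (Id p q) (Id p' q')
| alpha_Box p p' : alpha p p' -> alpha (Box p) (Box p')
| alpha_All x p p' : alpha p p' -> alpha (All x p) (All x p').

End Syntax.

Inductive pform : Type :=
| PVar of nat
| PBot
| PTop
| PNeg of pform
| PImp of pform & pform
| POr of pform & pform
| PAnd of pform & pform.

Fixpoint ptruth (v : nat -> bool) (p : pform) : bool :=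
  match p with
  | PVar x => v x
  | PBot => false
  | PTop => true
  | PNeg p => ~~ ptruth v p
  | PImp p q => ptruth v p ==> ptruth v q
  | POr p q => ptruth v p || ptruth v q
  | PAnd p q => ptruth v p && ptruth v q
  end.

Definition tautology (p : pform) : Prop := forall v, ptruth v p.

Fixpoint pinst (C : constants) (s : nat -> expr C) (p : pform) : expr C :=
  match p with
  | PVar x => s x
  | PBot => Bot
  | PTop => Top
  | PNeg p => Neg (pinst s p)
  | PImp p q => Imp (pinst s p) (pinst s q)
  | POr p q => Or (pinst s p) (pinst s q)
  | PAnd p q => And (pinst s p) (pinst s q)
  end.

Inductive system : Type := S3 | S4 | S5.

Section Deduction.
Variable C : constants.
Implicit Types (p q r : expr C) (x : nat).

(* That the instances are formulas is required in [axiom]; this forces, e.g.,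
   x to be free in both p and q in [ax_All_Id] and [ax_All_Imp], and in q in
   [ax_All_const]. *)
Inductive schema : system -> expr C -> Prop :=
| ax_taut m t s : tautology t -> schema m (pinst s t)
| ax_T m p : schema m (Imp (Box p) p)
| ax_K m p q : schema m (Imp (Box (Imp p q)) (Imp (Box p) (Box q)))
| ax_S3 m p q : schema m (Imp (Box (Imp p q)) (Box (Imp (Box p) (Box q))))
| ax_alpha m p q : alpha p q -> schema m (Id p q)
| ax_Id_Imp m p q : schema m (Imp (Id p q) (Imp p q))
| ax_Id_subst m p x q r : Fm p -> x \in fv p ->
    schema m (Imp (Id q r) (Id (subst p x q) (subst p x r)))
| ax_All_Id m x p q :
    schema m (Imp (All x (Id p q)) (Id (All x p) (All x q)))
| ax_All_inst m x p q : schema m (Imp (All x p) (subst p x q))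
| ax_All_Imp m x p q :
    schema m (Imp (All x (Imp p q)) (Imp (All x p) (All x q)))
| ax_All_const m x p q : x \notin fv p ->
    schema m (Imp (All x (Imp p q)) (Imp p (All x q)))
| ax_Box_All m x p : schema m (Imp (Box (All x p)) (All x (Box p)))
| ax_All_Box m x p : schema m (Imp (All x (Box p)) (Box (All x p)))
| ax_S4 m p : m <> S3 -> schema m (Imp (Box p) (Box (Box p)))
| ax_S5 p : schema S5 (Imp (Neg (Box p)) (Box (Neg (Box p)))).

Inductive axiom (m : system) : expr C -> Prop :=
| axiom_schema p : schema m p -> Fm p -> axiom m p
| axiom_gen x p : axiom m p -> x \in fv p -> axiom m (All x p).

Inductive derives (m : system) (Phi : expr C -> Prop) : expr C -> Prop :=
| derives_premise p : Phi p -> derives m Phi p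
| derives_axiom p : axiom m p -> derives m Phi p
| derives_MP p q : derives m Phi p -> derives m Phi (Imp p q) -> derives m Phi q
| derives_AN p : axiom m p -> derives m Phi (Box p).

End Deduction.

Section Prealgebra.
Variables (M : Type) (fbot ftop : M) (fneg : M -> M).
Variables (for_ fand fimp : M -> M -> M) (le : M -> M -> Prop).

Definition equiv_of (a b : M) : Prop := le a b /\ le b a.

Definition preorder : Prop :=
  (forall a, le a a) /\ (forall a b c, le a b -> le b c -> le a c).

Definition congruence2 (f : M -> M -> M) : Prop :=
  forall a a' b b', equiv_of a a' -> equiv_of b b' -> equiv_of (f a b) (f a' b').

(* The Boolean algebra B, with projection pi, is the quotient of M by
   [equiv_of] with the induced order and the induced operations. *)
Record boolean_quotient (d : Order.disp_t) (B : ctbDistrLatticeType d)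
    (pi : M -> B) : Prop := BooleanQuotient {
  pi_surj : forall u, exists a, pi a = u;
  pi_eq : forall a b, pi a = pi b <-> equiv_of a b;
  pi_le : forall a b, (pi a <= pi b)%O <-> le a b;
  pi_bot : pi fbot = \bot%O;
  pi_top : pi ftop = \top%O;
  pi_neg : forall a, pi (fneg a) = (~` pi a)%O;
  pi_or : forall a b, pi (for_ a b) = (pi a `|` pi b)%O;
  pi_and : forall a b, pi (fand a b) = (pi a `&` pi b)%O;
  pi_imp : forall a b, pi (fimp a b) = (~` pi a `|` pi b)%O }.

Record boolean_prealgebra : Prop := BooleanPrealgebra {
  prealgebra_preorder : preorder;
  prealgebra_neg : forall a a', equiv_of a a' -> equiv_of (fneg a) (fneg a');
  prealgebra_or : congruence2 for_;
  prealgebra_and : congruence2 fand;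
  prealgebra_imp : congruence2 fimp;
  prealgebra_quotient : exists (d : Order.disp_t) (B : ctbDistrLatticeType d)
    (pi : M -> B), boolean_quotient pi }.

End Prealgebra.

Record domain (C : constants) := Domain {
  carrier :> Type;
  TRUE : carrier -> Prop;
  NEC : carrier -> Prop;
  fbot : carrier;
  ftop : carrier;
  fbox : carrier -> carrier;
  fneg : carrier -> carrier;
  for_ : carrier -> carrier -> carrier;
  fand : carrier -> carrier -> carrier;
  fimp : carrier -> carrier -> carrier;
  fid : carrier -> carrier -> carrier;
  fall : (carrier -> carrier) -> carrier;
  Gam : C -> carrier;
  Gam_bot : Gam (cbot C) = fbot;
  Gam_top : Gam (ctop C) = ftop }.

Arguments fbot {C} _.
Arguments ftop {C} _.

Section Models.
Variables (C : constants) (M : domain C).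
Implicit Types (a b : M) (t : M -> M) (g : nat -> M) (p q : expr C).

Fixpoint eval g p : M :=
  match p with
  | Var x => g x
  | Const c => Gam M c
  | Neg p => fneg (eval g p)
  | Imp p q => fimp (eval g p) (eval g q)
  | Or p q => for_ (eval g p) (eval g q)
  | And p q => fand (eval g p) (eval g q)
  | Id p q => fid (eval g p) (eval g q)
  | Box p => fbox (eval g p)
  | All x p => fall (fun a => eval (update g x a) p)
  end.

Definition definable_by p x g t : Prop :=
  Fm p /\ forall a, t a = eval (update g x a) p.

Definition definable t : Prop :=
  exists p x g, x \in fv p /\ definable_by p x g t.

(* "b is the denotation of a sentence".  Here a sentence is a formula, possibly
   with free variables, interpreted under some assignment.  If only closed
   formulas were allowed, the necessitation of the axiom [ax_All_const], whose
   antecedent p may have free variables, would not be valid: let M be the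
   powerset of {1,2,3} with TRUE = {a | 1 \in a}, NEC = {{1,2,3}}, the set
   operations, fbox a and fid a b the full set or the empty set according to
   whether a \in NEC and a = b, and let i \in fall t iff every t a contains the
   block of i in the partition {{1},{2,3}}.  All closed formulas denote unions
   of blocks, all other conditions below hold, and
   Box (All x (y -> q) -> (y -> All x q)) with q := y /\ (x \/ ~ x) is false
   when y denotes {2}. *)
Definition denotation b : Prop := exists p g, Fm p /\ b = eval g p.

Definition leM a b : Prop := NEC (fimp a b).
Definition approxM : M -> M -> Prop := equiv_of leM.

Definition normal : Prop := exists a, NEC a.

Record true_conditions : Prop := TrueConditions {
  true_bot : ~ TRUE (fbot M);
  true_top : TRUE (ftop M);
  true_imp : forall a b, TRUE (fimp a b) <-> (TRUE a -> TRUE b);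
  true_neg : forall a, TRUE (fneg a) <-> ~ TRUE a;
  true_and : forall a b, TRUE (fand a b) <-> TRUE a /\ TRUE b;
  true_or : forall a b, TRUE (for_ a b) <-> TRUE a \/ TRUE b;
  true_box : forall a, TRUE (fbox a) <-> NEC a;
  true_id : forall a b, TRUE (fid a b) <-> a = b;
  true_all : forall t, definable t -> (forall a, TRUE (t a)) -> TRUE (fall t) }.

Record nec_conditions : Prop := NecConditions {
  nec_true : forall a, NEC a -> TRUE a;
  nec_up : forall a b, NEC a -> leM a b -> NEC b;
  nec_and : forall a b, NEC a -> NEC b -> NEC (fand a b) }.

Record order_conditions : Prop := OrderConditions {
  le_id_refl : forall a, leM (ftop M) (fid a a);
  le_id_imp : forall a b, leM (fid a b) (fimp a b);
  le_id_def : forall t a b, definable t -> leM (fid a b) (fid (t a) (t b));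
  le_box : forall a, leM (fbox a) a;
  le_box_K : forall a b, leM (fbox (fimp a b)) (fimp (fbox a) (fbox b));
  le_box_S3 : forall a b,
    leM (fbox (fimp a b)) (fbox (fimp (fbox a) (fbox b)));
  le_all_id : forall p q x g t1 t2 t,
    definable_by p x g t1 -> definable_by q x g t2 ->
    (forall a, t a = fid (t1 a) (t2 a)) ->
    leM (fall t) (fid (fall t1) (fall t2));
  le_all_imp : forall p q x g t1 t2 t,
    definable_by p x g t1 -> definable_by q x g t2 ->
    (forall a, t a = fimp (t1 a) (t2 a)) ->
    leM (fall t) (fimp (fall t1) (fall t2));
  le_all_inst : forall t a, definable t -> leM (fall t) (t a);
  le_all_const : forall q x g t' t b,
    definable_by q x g t' -> denotation b ->
    (forall a, t a = fimp b (t' a)) ->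
    leM (fall t) (fimp b (fall t'));
  box_all : forall t, definable t ->
    approxM (fbox (fall t)) (fall (fun a => fbox (t a)));
  nec_all : forall t, definable t -> (forall a, NEC (t a)) -> NEC (fall t) }.

Record S3_model : Prop := S3Model {
  S3_prealgebra : normal ->
    boolean_prealgebra (fbot M) (ftop M) (@fneg C M) (@for_ C M) (@fand C M)
      (@fimp C M) leM;
  S3_true : true_conditions;
  S3_nec : normal -> nec_conditions;
  S3_order : normal -> order_conditions }.

Definition S4_model : Prop :=
  [/\ S3_model, normal & forall a, leM (fbox a) (fbox (fbox a))].

Definition S5_model : Prop :=
  S4_model /\ forall a, leM (fneg (fbox a)) (fbox (fneg (fbox a))).

Definition model (m : system) : Prop :=
  match m with S3 => S3_model | S4 => S4_model | S5 => S5_model end.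

Definition sat g p : Prop := TRUE (eval g p).

End Models.

Definition entails (C : constants) (m : system) (Phi : expr C -> Prop)
    (phi : expr C) : Prop :=
  forall M : domain C, model M m -> normal M ->
  forall g : nat -> M, (forall psi, Phi psi -> sat g psi) -> sat g phi.

(* Main.v *)
(** Every axiom denotes a necessary proposition in every normal model, under
    every assignment; this is stronger than truth, so it also covers Axiom
    Necessitation, and it survives generalization because [NEC] is closed under
    [fall] of definable functions.  For tautologies it holds because a
    propositional tautology evaluates to the top of any Boolean algebra; for the
    axioms with substitution or renaming, one needs the substitution lemma
    (evaluating [ssubst s p] under [g] is evaluating [p] under [eval g \o s]);
    the remaining schemas are conditions on the model. *)
Require Import Defs.
From mathcomp Require Import all_boot all_order.
From Stdlib Require Import FunctionalExtensionality.
Import Order.Theory.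

Set Implicit Arguments.
Unset Strict Implicit.
Unset Printing Implicit Defensive.

Lemma forall_cat (T : eqType) (P : T -> Prop) (s1 s2 : seq T) :
  {in s1 ++ s2, forall x, P x} <->
  {in s1, forall x, P x} /\ {in s2, forall x, P x}.
Proof.
split=> [Ps|[Ps1 Ps2] x]; last by rewrite mem_cat => /orP[/Ps1|/Ps2].
by split=> x xs; apply: Ps; rewrite mem_cat xs ?orbT.
Qed.

Lemma comp_update (T U : Type) (h : T -> U) (f : nat -> T) x a :
  h \o update f x a =1 update (h \o f) x (h a).
Proof. by move=> y; rewrite /= /update; case: eqP. Qed.

Lemma update_same (T : Type) (f : nat -> T) x a : update f x a x = a.
Proof. by rewrite /update eqxx. Qed.

Lemma update_notin (T : Type) (f : nat -> T) x a (s : seq nat) :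
  x \notin s -> {in s, update f x a =1 f}.
Proof.
by move=> xNs y ys; rewrite /update; case: eqVneq ys xNs => // -> ->.
Qed.

Section BooleanTautologies.
Context {d : Order.disp_t} {B : ctbDistrLatticeType d}.
Local Open Scope order_scope.
Implicit Types (b : nat -> B) (v : nat -> bool) (c u w : B) (t : pform).

Definition literal (e : bool) u : B := if e then u else ~` u.

Lemma literal_compl e u : literal (~~ e) (~` u) = literal e u.
Proof. by case: e; rewrite /literal //= complK. Qed.

Lemma le_literal_join c e u f w :
  c <= literal e u -> c <= literal f w -> c <= literal (e || f) (u `|` w).
Proof.
case: e f => [] [] /= le_cu le_cw; last by rewrite complU lexI le_cu.
all: by rewrite lexU2 ?le_cu ?le_cw ?orbT.
Qed.

Lemma le_literal_meet c e u f w :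
  c <= literal e u -> c <= literal f w -> c <= literal (e && f) (u `&` w).
Proof.
rewrite -(literal_compl e) -(literal_compl f) -(literal_compl (e && f)).
by rewrite negb_and complI; apply: le_literal_join.
Qed.

Lemma le_split_compl c u w : c `&` u <= w -> c `&` ~` u <= w -> c <= w.
Proof.
by move=> le_cu le_cNu; rewrite -(meetx1 c) -(joinxC u) meetUr leUx le_cu.
Qed.

Lemma eq_top_literals b (s : seq nat) u :
    (forall c v, {in s, forall x, c <= literal (v x) (b x)} -> c <= u) ->
  u = \top.
Proof.
move=> le_u; apply/eqP; rewrite -le1x; move: le_u.
elim: s => [|x s IHs] le_u; first exact: (le_u \top xpredT).
apply: IHs => c v le_c.
have le_half e : c `&` literal e (b x) <= u.
  apply: (le_u _ (update v x e)) => y; rewrite inE /update.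
  case: eqVneq => [-> _|_ /= ys]; first exact: leIr.
  by rewrite leIxl ?le_c.
exact: le_split_compl (le_half true) (le_half false).
Qed.

Fixpoint peval b t : B :=
  match t with
  | PVar x => b x
  | PBot => \bot
  | PTop => \top
  | PNeg p => ~` peval b p
  | PImp p q => ~` peval b p `|` peval b q
  | POr p q => peval b p `|` peval b q
  | PAnd p q => peval b p `&` peval b q
  end.

Fixpoint pvars t : seq nat :=
  match t with
  | PVar x => [:: x]
  | PBot | PTop => [::]
  | PNeg p => pvars p
  | PImp p q | POr p q | PAnd p q => pvars p ++ pvars q
  end.

(* Below [c] the value of each variable under [b] is decided by [v], hence so is
   the value of [t]. *)
Lemma le_literal_peval b v c t :
    {in pvars t, forall x, c <= literal (v x) (b x)} ->
  c <= literal (ptruth v t) (peval b t).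
Proof.
elim: t => [x|||p IHp|p IHp q IHq|p IHp q IHq|p IHp q IHq] /=.
- by apply; rewrite inE.
- by rewrite /literal compl0 lex1.
- by rewrite /literal lex1.
- by move/IHp; rewrite literal_compl.
- case/forall_cat=> /IHp le_p /IHq le_q.
  by rewrite implybE le_literal_join ?literal_compl.
- by case/forall_cat=> /IHp le_p /IHq le_q; apply: le_literal_join.
- by case/forall_cat=> /IHp le_p /IHq le_q; apply: le_literal_meet.
Qed.

Lemma peval_tautology b t : tautology t -> peval b t = \top.
Proof.
move=> taut; apply: (@eq_top_literals b (pvars t)) => c v.
by move/le_literal_peval; rewrite taut.
Qed.

End BooleanTautologies.

Lemma leq_foldr_maxn (s : seq nat) x : x \in s -> x <= foldr maxn 0 s.
Proof. by move=> xs; rewrite foldrE (leq_bigmax_seq (F := id)). Qed.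

Lemma binder_notin (C : constants) (s : nat -> expr C) x p y :
  y \in fv p -> y != x -> binder s x p \notin fv (s y).
Proof.
move=> yp neq_yx; rewrite /binder; set l := flatten _.
have sub_l z : z \in fv (s y) -> z \in l.
  move=> zs; apply/flattenP; exists (fv (s y)) => //.
  by apply: map_f; rewrite mem_filter neq_yx.
case: ifPn => [_|xNl]; last exact: contra (sub_l x) xNl.
by apply/negP => /sub_l/leq_foldr_maxn; rewrite ltnn.
Qed.

Section Evaluation.
Context {C : constants} {M : domain C}.
Implicit Types (g : nat -> M) (p q : expr C) (s : nat -> expr C) (x : nat).

Lemma eq_fall (t1 t2 : M -> M) : t1 =1 t2 -> fall t1 = fall t2.
Proof. by move=> eq_t; congr fall; apply: functional_extensionality. Qed.

Lemma eq_eval_fv g1 g2 p : {in fv p, g1 =1 g2} -> eval g1 p = eval g2 p.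
Proof.
elim: p g1 g2 => [x|c|p IHp|p IHp q IHq|p IHp q IHq|p IHp q IHq|p IHp q IHq
  |p IHp|x p IHp] g1 g2 eq_g //=.
- by apply: eq_g; rewrite inE.
- by rewrite (IHp g1 g2).
- by case/forall_cat: eq_g => /IHp -> /IHq ->.
- by case/forall_cat: eq_g => /IHp -> /IHq ->.
- by case/forall_cat: eq_g => /IHp -> /IHq ->.
- by case/forall_cat: eq_g => /IHp -> /IHq ->.
- by rewrite (IHp g1 g2).
- apply: eq_fall => a; apply: IHp => y yp.
  rewrite /update; case: eqVneq => // neq_yx.
  by apply: eq_g; rewrite mem_filter neq_yx.
Qed.

Lemma eval_update_notin g x a p :
  x \notin fv p -> eval (update g x a) p = eval g p.
Proof. by move=> xNp; apply/eq_eval_fv/update_notin. Qed.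

Lemma eval_ssubst g s p : eval g (ssubst s p) = eval (eval g \o s) p.
Proof.
elim: p g s => [x|c|p IHp|p IHp q IHq|p IHp q IHq|p IHp q IHq|p IHp q IHq
  |p IHp|x p IHp] g s /=; rewrite ?IHp ?IHq //.
apply: eq_fall => a; rewrite IHp; apply: eq_eval_fv => y yp.
rewrite comp_update /= update_same /update; case: eqVneq => //= neq_yx.
exact/(@eval_update_notin g)/binder_notin.
Qed.

Lemma eval_subst g p x q :
  eval g (subst p x q) = eval (update g x (eval g q)) p.
Proof.
by rewrite eval_ssubst; apply: eq_eval_fv => y _; rewrite comp_update.
Qed.

Lemma eval_rename g p x y a :
    y \notin fv p ->
  eval (update g y a) (subst p x (Var y)) = eval (update g x a) p.
Proof.
move=> yNp; rewrite eval_subst /= update_same; apply: eq_eval_fv => z zp.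
by rewrite /update; case: ifP => // _; apply: (update_notin g a yNp zp).
Qed.

Lemma eval_alpha g p q : alpha p q -> eval g p = eval g q.
Proof.
move=> alpha_pq; elim: alpha_pq g => {p q} //=.
- by move=> x y p yNp g; apply: eq_fall => a; rewrite eval_rename.
- by move=> p q r _ eq_pq _ eq_qr g; rewrite eq_pq.
- by move=> p p' _ eq_p g; rewrite eq_p.
- by move=> p p' q q' _ eq_p _ eq_q g; rewrite eq_p eq_q.
- by move=> p p' q q' _ eq_p _ eq_q g; rewrite eq_p eq_q.
- by move=> p p' q q' _ eq_p _ eq_q g; rewrite eq_p eq_q.
- by move=> p p' q q' _ eq_p _ eq_q g; rewrite eq_p eq_q.
- by move=> p p' _ eq_p g; rewrite eq_p.
- by move=> x p p' _ eq_p g; apply: eq_fall.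
Qed.

End Evaluation.

Definition quotient_map (C : constants) (M : domain C) (d : Order.disp_t)
    (B : ctbDistrLatticeType d) (pi : M -> B) : Prop :=
  boolean_quotient (fbot M) (ftop M) (@fneg C M) (@for_ C M) (@fand C M)
    (@fimp C M) (@leM C M) pi.

Lemma quotient_map_pinst (C : constants) (M : domain C) (d : Order.disp_t)
    (B : ctbDistrLatticeType d) (pi : M -> B) (g : nat -> M)
    (s : nat -> expr C) t :
  quotient_map pi -> pi (eval g (pinst s t)) = peval (pi \o eval g \o s) t.
Proof.
move=> quo.
elim: t => //= [||p IHp|p IHp q IHq|p IHp q IHq|p IHp q IHq].
- by rewrite Gam_bot (pi_bot quo).
- by rewrite Gam_top (pi_top quo).
- by rewrite (pi_neg quo) IHp.
- by rewrite (pi_imp quo) IHp IHq.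
- by rewrite (pi_or quo) IHp IHq.
- by rewrite (pi_and quo) IHp IHq.
Qed.

Section NormalModel.
Context {C : constants} {M : domain C}.
Hypotheses (M_S3 : S3_model M) (M_normal : normal M).
Implicit Types (a : M) (g : nat -> M) (p q : expr C).

Lemma exists_quotient_map :
  exists (d : Order.disp_t) (B : ctbDistrLatticeType d) (pi : M -> B),
    quotient_map pi.
Proof. exact: prealgebra_quotient (S3_prealgebra M_S3 M_normal). Qed.

Lemma leM_top a : leM a (ftop M).
Proof.
have [d [B [pi quo]]] := exists_quotient_map.
by apply/(pi_le quo); rewrite (pi_top quo) lex1.
Qed.

Lemma nec_top : NEC (ftop M).
Proof.
by have [a nec_a] := M_normal; apply: nec_up nec_a (leM_top a); apply: S3_nec.
Qed.

Lemma nec_of_le_top a : leM (ftop M) a -> NEC a.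
Proof. exact/nec_up/nec_top/S3_nec. Qed.

Lemma nec_tautology g t s : tautology t -> NEC (eval g (pinst s t)).
Proof.
move=> taut; apply: nec_of_le_top.
have [d [B [pi quo]]] := exists_quotient_map; apply/(pi_le quo).
by rewrite (quotient_map_pinst _ _ _ quo) peval_tautology // lex1.
Qed.

Lemma nec_alpha g p q : alpha p q -> NEC (eval g (Id p q)).
Proof.
move=> alpha_pq; apply: nec_of_le_top; rewrite /= (eval_alpha g alpha_pq).
exact/le_id_refl/S3_order.
Qed.

End NormalModel.

Section Definability.
Context {C : constants} {M : domain C}.
Implicit Types (g : nat -> M) (p : expr C).

Lemma definable_by_eval g x p :
  Fm p -> definable_by p x g (fun a => eval (update g x a) p).
Proof. by []. Qed.

Lemma definable_eval g x p :
  x \in fv p -> Fm p -> definable (fun a => eval (update g x a) p).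
Proof. by move=> xp Fp; exists p, x, g. Qed.

Lemma denotation_eval g p : Fm p -> denotation (eval g p).
Proof. by move=> Fp; exists p, g. Qed.

End Definability.

Lemma model_S4 (C : constants) (M : domain C) m :
  m <> S3 -> model M m -> S4_model M.
Proof. by case: m => //= _ []. Qed.

Lemma model_S3 (C : constants) (M : domain C) m : model M m -> S3_model M.
Proof. by case: m => [//|/(@model_S4 _ _ S4)[]|/(@model_S4 _ _ S5)[]]. Qed.

Lemma Fm_axiom (C : constants) m (p : expr C) : axiom m p -> Fm p.
Proof. by elim=> //= x q _ Fq ->. Qed.

Section Soundness.
Context {C : constants} {M : domain C} {m : system}.
Hypotheses (M_model : model M m) (M_normal : normal M).
Implicit Types (g : nat -> M) (p : expr C).

Let M_S3 : S3_model M := model_S3 M_model.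
Let M_order : order_conditions M := S3_order M_S3 M_normal.

Lemma nec_schema g p : schema m p -> Fm p -> NEC (eval g p).
Proof.
move=> schema_p; case: m p / schema_p M_model.
- by move=> m' t s taut _ _; apply: nec_tautology.
- by move=> m' p _ _; apply: le_box.
- by move=> m' p q _ _; apply: le_box_K.
- by move=> m' p q _ _; apply: le_box_S3.
- by move=> m' p q alpha_pq _ _; apply: nec_alpha.
- by move=> m' p q _ _; apply: le_id_imp.
- move=> m' p x q r Fp xp _ _ /=; rewrite !eval_subst.
  exact: (le_id_def M_order _ _ (definable_eval g xp Fp)).
- move=> m' x p q _ /= /andP[/andP[_ /andP[Fp Fq]] _].
  exact: (le_all_id M_order (definable_by_eval g x Fp)
            (definable_by_eval g x Fq)).
- move=> m' x p q _ /= /andP[/andP[xp Fp] _]; rewrite eval_subst.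
  exact: (le_all_inst M_order _ (definable_eval g xp Fp)).
- move=> m' x p q _ /= /andP[/andP[_ /andP[Fp Fq]] _].
  exact: (le_all_imp M_order (definable_by_eval g x Fp)
            (definable_by_eval g x Fq)).
- move=> m' x p q xNp _ /= /andP[/andP[_ /andP[Fp Fq]] _].
  apply: (le_all_const M_order (definable_by_eval g x Fq)
            (denotation_eval g Fp)) => a.
  by rewrite eval_update_notin.
- move=> m' x p _ /= /andP[/andP[xp Fp] _].
  by case: (box_all M_order (definable_eval g xp Fp)).
- move=> m' x p _ /= /andP[/andP[xp Fp] _].
  by case: (box_all M_order (definable_eval g xp Fp)).
- move=> m' p m'_neq_S3 /(model_S4 m'_neq_S3)[_ _ le_box_box] _.
  exact: le_box_box.
- by move=> p [_ le_neg_box] _; apply: le_neg_box.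
Qed.

Lemma nec_axiom g p : axiom m p -> NEC (eval g p).
Proof.
move=> ax; elim: ax g => {p} [p sp Fp|x p ax IHp xp] g; first exact: nec_schema.
apply: (nec_all M_order) => [|a]; last exact: IHp.
exact: definable_eval xp (Fm_axiom ax).
Qed.

End Soundness.

Theorem theorem15 (C : constants) (m : system) (Phi : expr C -> Prop)
    (phi : expr C) (hPhi : forall psi, Phi psi -> Fm psi) (hphi : Fm phi) :
  derives m Phi phi -> entails m Phi phi.
Proof.
move=> der M M_model M_normal g sat_Phi; have M_S3 := model_S3 M_model.
have M_true := S3_true M_S3.
elim: der => {phi hphi} [p /sat_Phi //|p ax|p q _ sat_p _ sat_pq|p ax].
- exact: (nec_true (S3_nec M_S3 M_normal)) (nec_axiom M_model M_normal g ax).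
- exact: (true_imp M_true _ _).1 sat_pq sat_p.
- by apply/(true_box M_true); apply: nec_axiom ax.
Qed.
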